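(* Consider the system of ionized gas dynamics. For every $\eta_0\in\mathbb R$, with $\mathcal T=\mathcal T^{\eta_0}$ the function of the context, one has $$\frac{d}{d\alpha}p\left(\alpha,\mathcal T(\alpha)\right)>0\qquad\text{for }\alpha\in(0,\alpha_\infty).$$ Consider the projections on the $(\alpha,T)$-plane of the rarefaction curves corresponding to the eigenvalues $\lambda_\pm$ through the point $(\alpha_0,T_0)$, and suppose that they are contained in the region where $R_\pm\nabla\lambda_\pm>0$. Then the projection of the 1-rarefaction curve is the integral curve $T=\mathcal T(\alpha)$ through $(\alpha_0,T_0)$ restricted to $\alpha\in(0,\alpha_0]$, and the projection of the 2-rarefaction curve is the same integral curve restricted to $\alpha\in[\alpha_0,\alpha_\infty)$.
   Context: Fix positive constants $a^2$, $T_{\rm i}$, $\kappa$. For degree of ionization $\alpha\in(0,1)$ and temperature $T>0$: $p=p(\alpha,T)=\frac1\kappa\frac{1-\alpha^2}{\alpha^2}T^{5/2}e^{-T_{\rm i}/T}$, $v=a^2(1+\alpha)T/p$, $e=a^2\left[\frac32(1+\alpha)T+T_{\rm i}\alpha\right]$, and the dimensionless entropy is $\eta(\alpha,T)=-2\log\frac{1-\alpha}{\alpha}+\left(\frac52+\frac{T_{\rm i}}{T}\right)(1+\alpha)$. The system in Lagrangian coordinates $v_t-u_\xi=0$, $u_t+p_\xi=0$, $(e+\frac12u^2)_t+(pu)_\xi=0$ has eigenvalues $\lambda_\pm=\pm\lambda$ and $0$, where $\lambda>0$ and $$\lambda^2=\frac{p^2\left[\frac52+\frac12\alpha(1-\alpha)\left(\frac52+\frac{T_{\rm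 i}}{T}\right)^2\right]}{a^2T(1+\alpha)\left[\frac32+\frac12\alpha(1-\alpha)\left(\frac{15}{4}+\frac{3T_{\rm i}}{T}+\frac{T_{\rm i}^2}{T^2}\right)\right]}.$$ In the variables $(\alpha,u,T)$ the characteristic fields of $\lambda_\pm$ are $$R_\pm=\left(\pm\frac{\frac12\alpha(1-\alpha^2)\frac{T_{\rm i}}{T}}{A},\ \frac p\lambda,\ \pm\frac{1+\frac12\alpha(1-\alpha)\left(\frac52+\frac{T_{\rm i}}{T}\right)}{A}\,T\right),\quad A=\tfrac52+\tfrac12\alpha(1-\alpha)\left(\tfrac52+\tfrac{T_{\rm i}}{T}\right)^2.$$ The entropy $\eta$ is constant along integral curves of $R_\pm$, whose projections on the $(\alpha,T)$-plane are the curves $\eta(\alpha,T)=\eta_0$, i.e. the graphs of $$\mathcal T^{\eta_0}(\alpha)=\frac{(1+\alpha)T_{\rm i}}{2\log\frac{1-\alpha}{\alpha}-\frac52(1+\alpha)+\eta_0},\qquad\alpha\in(0,\alpha_\infty),$$ where $\alpha_\infty=\alpha_\infty(\eta_0)\in(0,1)$ is the unique zero of the denominator (so that $\mathcal T^{\eta_0}>0$ on $(0,\alpha_\infty)$). For the curve through $(\alpha_0,T_0)$, $\eta_0=\eta(\alpha_0,T_0)$. The 1-rarefaction (resp. 2-rarefaction) curve through a state is the maximal portion, starting at that state, of the integral curve of $R_-$ (resp. $R_+$) along which $\lambda_-$ (resp. $\lambda_+$) is increasing as one moves away from the state (the given state is the left/back state of the wave). *)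

(* Defs.v *)
From Stdlib Require Import Reals Lra.
From Coquelicot Require Import Coquelicot.
Open Scope R_scope.

(** Standard-library reals with Coquelicot.  [a2] stands for the constant a^2,
    [Ti] for the ionization temperature; thermodynamic arguments are the degree
    of ionization [a] in (0,1) and the temperature [T > 0]. *)

Definition pressure (Ti kappa a T : R) : R :=
  / kappa * ((1 - a ^ 2) / a ^ 2) * Rpower T (5 / 2) * exp (- Ti / T).

Definition volume (a2 Ti kappa a T : R) : R :=
  a2 * (1 + a) * T / pressure Ti kappa a T.

Definition energy (a2 Ti a T : R) : R :=
  a2 * (3 / 2 * (1 + a) * T + Ti * a).

Definition entropy (Ti a T : R) : R :=
  - 2 * ln ((1 - a) / a) + (5 / 2 + Ti / T) * (1 + a).

Definition coefA (Ti a T : R) : R :=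
  5 / 2 + / 2 * a * (1 - a) * (5 / 2 + Ti / T) ^ 2.

Definition lambda_sq (a2 Ti kappa a T : R) : R :=
  (pressure Ti kappa a T) ^ 2 * coefA Ti a T
  / (a2 * T * (1 + a)
     * (3 / 2 + / 2 * a * (1 - a) * (15 / 4 + 3 * Ti / T + Ti ^ 2 / T ^ 2))).

Definition lambda (a2 Ti kappa a T : R) : R := sqrt (lambda_sq a2 Ti kappa a T).

(** States (alpha, u, T); the same type is used for tangent vectors. *)
Record state : Type := State { deg : R; vel : R; temp : R }.

Definition admissible (q : state) : Prop := 0 < deg q < 1 /\ 0 < temp q.

Definition lambda_plus (a2 Ti kappa : R) (q : state) : R :=
  lambda a2 Ti kappa (deg q) (temp q).

Definition lambda_minus (a2 Ti kappa : R) (q : state) : R :=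
  - lambda a2 Ti kappa (deg q) (temp q).

Definition R_plus (a2 Ti kappa : R) (q : state) : state :=
  let (a, _, T) := q in
  State (/ 2 * a * (1 - a ^ 2) * (Ti / T) / coefA Ti a T)
        (pressure Ti kappa a T / lambda a2 Ti kappa a T)
        ((1 + / 2 * a * (1 - a) * (5 / 2 + Ti / T)) / coefA Ti a T * T).

Definition R_minus (a2 Ti kappa : R) (q : state) : state :=
  let (a, _, T) := q in
  State (- (/ 2 * a * (1 - a ^ 2) * (Ti / T) / coefA Ti a T))
        (pressure Ti kappa a T / lambda a2 Ti kappa a T)
        (- ((1 + / 2 * a * (1 - a) * (5 / 2 + Ti / T)) / coefA Ti a T * T)).

(** X . grad f at [q]. *)
Definition along (X : state -> state) (f : state -> R) (q : state) : R :=
  deg (X q) * Derive (fun a => f (State a (vel q) (temp q))) (deg q)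
  + vel (X q) * Derive (fun u => f (State (deg q) u (temp q))) (vel q)
  + temp (X q) * Derive (fun T => f (State (deg q) (vel q) T)) (temp q).

Definition in_itv (lo hi : Rbar) (s : R) : Prop := Rbar_lt lo s /\ Rbar_lt s hi.

Definition integral_curve (X : state -> state) (q0 : state)
    (lo hi : Rbar) (g : R -> state) : Prop :=
  in_itv lo hi 0 /\ g 0 = q0 /\
  forall s, in_itv lo hi s ->
    admissible (g s) /\
    is_derive (fun r => deg (g r)) s (deg (X (g s))) /\
    is_derive (fun r => vel (g r)) s (vel (X (g s))) /\
    is_derive (fun r => temp (g r)) s (temp (X (g s))).

Definition maximal_integral_curve (X : state -> state) (q0 : state)
    (lo hi : Rbar) (g : R -> state) : Prop :=
  integral_curve X q0 lo hi g /\
  forall lo' hi' g',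
    integral_curve X q0 lo' hi' g' ->
    (forall s, in_itv lo hi s -> in_itv lo' hi' s /\ g' s = g s) ->
    lo' = lo /\ hi' = hi.

(** [f] is strictly increasing as the parameter moves from 0 to [s],
    in whichever direction this is. *)
Definition increasing_away (f : R -> R) (s : R) : Prop :=
  forall r1 r2,
    (0 <= r1 < r2 /\ r2 <= s) \/ (s <= r2 /\ r2 < r1 <= 0) -> f r1 < f r2.

(** The set of all states reached from [q0] along the maximal integral curve of
    [X] with [lam] increasing all the way: every portion starting at [q0] along
    which [lam] increases consists of such states, so this is the largest one.
    The orientation is not prescribed by that of [X] but by the growth of [lam];
    [q0] itself always belongs to the curve. *)
Definition rarefaction_curve (X : state -> state) (lam : state -> R)
    (q0 q : state) : Prop :=
  exists lo hi g s,
    maximal_integral_curve X q0 lo hi g /\ in_itv lo hi s /\ g s = q /\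
    increasing_away (fun r => lam (g r)) s.

Definition projection (S : state -> Prop) (a T : R) : Prop :=
  exists u, S (State a u T).

Definition curve_den (eta0 a : R) : R :=
  2 * ln ((1 - a) / a) - 5 / 2 * (1 + a) + eta0.

Definition curve_T (Ti eta0 a : R) : R := (1 + a) * Ti / curve_den eta0 a.

Definition is_alpha_inf (eta0 : R) : R -> Prop :=
  unique (fun a => 0 < a < 1 /\ curve_den eta0 a = 0).

Lemma curve_den_decr (eta0 a b : R) :
  0 < a -> a < b -> b < 1 -> curve_den eta0 b < curve_den eta0 a.
Proof.
  intros Ha Hab Hb. unfold curve_den.
  assert (H : ln ((1 - b) / b) < ln ((1 - a) / a)).
  { unfold Rdiv. rewrite !ln_mult; try lra; try (apply Rinv_0_lt_compat; lra).
    rewrite !ln_Rinv by lra.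
    assert (ln a < ln b) by (apply ln_increasing; lra).
    assert (ln (1 - b) < ln (1 - a)) by (apply ln_increasing; lra).
    lra. }
  lra.
Qed.

Lemma alpha_inf_exists (eta0 : R) : exists ainf, is_alpha_inf eta0 ainf.
Proof.
  pose (h := fun M => 1 / (1 + exp M)).
  assert (Hh : forall M, 0 < h M < 1).
  { intro M. pose proof (exp_pos M). unfold h. split.
    - apply Rdiv_lt_0_compat; lra.
    - apply Rlt_div_l; lra. }
  assert (Hd : forall M, curve_den eta0 (h M) = 2 * M - 5 / 2 * (1 + h M) + eta0).
  { intro M. pose proof (exp_pos M). unfold curve_den.
    replace ((1 - h M) / h M) with (exp M) by (unfold h; field; lra).
    now rewrite ln_exp. }
  pose (F := fun M => 2 * M - 5 / 2 * (1 + h M) + eta0).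
  assert (HF : continuity F).
  { intro M. apply derivable_continuous_pt. apply ex_derive_Reals_0.
    unfold F, h. auto_derive. pose proof (exp_pos M). lra. }
  pose (K := Rabs eta0 + 5).
  pose proof (Rle_abs eta0). pose proof (Rle_abs (- eta0)). rewrite Rabs_Ropp in *.
  pose proof (Rabs_pos eta0).
  destruct (IVT F (- K) K HF) as [M [_ HM]].
  - unfold K; lra.
  - unfold F, K. destruct (Hh (- (Rabs eta0 + 5))). lra.
  - unfold F, K. destruct (Hh (Rabs eta0 + 5)). lra.
  - exists (h M). split.
    + split; [apply Hh | now rewrite Hd].
    + intros b [Hb Hb0].
      assert (Ha0 : curve_den eta0 (h M) = 0) by now rewrite Hd.
      destruct (Hh M).
      destruct (Rtotal_order (h M) b) as [H'|[H'|H']]; [|exact H'|].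
      * pose proof (curve_den_decr eta0 (h M) b). lra.
      * pose proof (curve_den_decr eta0 b (h M)). lra.
Qed.

Lemma pressure_pos (Ti kappa a T : R) :
  0 < kappa -> 0 < a < 1 -> 0 < pressure Ti kappa a T.
Proof.
  intros Hk Ha. unfold pressure.
  repeat apply Rmult_lt_0_compat; try apply exp_pos.
  - now apply Rinv_0_lt_compat.
  - assert (0 < (1 - a) * (1 + a)) by (apply Rmult_lt_0_compat; lra). lra.
  - apply Rinv_0_lt_compat. apply pow_lt; lra.
Qed.

Lemma coefA_pos (Ti a T : R) : 0 < a < 1 -> 0 < coefA Ti a T.
Proof.
  intro Ha. unfold coefA.
  assert (0 <= (5 / 2 + Ti / T) ^ 2) by apply pow2_ge_0.
  assert (0 < a * (1 - a)) by nra. nra.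
Qed.

Lemma lambda_sq_pos (a2 Ti kappa a T : R) :
  0 < a2 -> 0 < Ti -> 0 < kappa -> 0 < a < 1 -> 0 < T ->
  0 < lambda_sq a2 Ti kappa a T.
Proof.
  intros Ha2 HTi Hk Ha HT. unfold lambda_sq.
  assert (0 < Ti / T) by now apply Rdiv_lt_0_compat.
  replace (3 * Ti / T) with (3 * (Ti / T)) by (field; lra).
  replace (Ti ^ 2 / T ^ 2) with ((Ti / T) ^ 2) by (field; lra).
  set (x := Ti / T) in *.
  pose proof (pressure_pos Ti kappa a T Hk Ha).
  pose proof (coefA_pos Ti a T Ha).
  assert (0 < a * (1 - a)) by nra.
  assert (0 < 15 / 4 + 3 * x + x ^ 2) by nra.
  apply Rdiv_lt_0_compat.
  - apply Rmult_lt_0_compat; [now apply pow_lt | assumption].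
  - repeat apply Rmult_lt_0_compat; try lra. nra.
Qed.

Lemma is_derive_pressure_a (Ti kappa a T : R) :
  0 < kappa -> 0 < a < 1 -> 0 < T ->
  is_derive (fun b => pressure Ti kappa b T) a
    (- 2 / (a * (1 - a ^ 2)) * pressure Ti kappa a T).
Proof.
  intros Hk Ha HT. unfold pressure. auto_derive.
  - apply Rmult_integral_contrapositive; lra.
  - assert (0 < (1 - a) * (1 + a)) by (apply Rmult_lt_0_compat; lra).
    field. repeat split; lra.
Qed.

Lemma is_derive_pressure_T (Ti kappa a T : R) :
  0 < kappa -> 0 < a < 1 -> 0 < T ->
  is_derive (fun S => pressure Ti kappa a S) T
    ((5 / 2 + Ti / T) / T * pressure Ti kappa a T).
Proof.
  intros Hk Ha HT. unfold pressure, Rpower. auto_derive.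
  - repeat split; lra.
  - change (- Ti * / T) with (- Ti / T). field. repeat split; lra.
Qed.

Lemma characteristic_identities (a2 Ti a T P A B : R) :
  0 < a2 -> 0 < a < 1 -> 0 < T -> 0 < P -> 0 < A -> 0 < B ->
  A = coefA Ti a T ->
  B = 3 / 2 + / 2 * a * (1 - a) * (15 / 4 + 3 * Ti / T + Ti ^ 2 / T ^ 2) ->
  let r1 := / 2 * a * (1 - a * (a * 1)) * (Ti / T) / A in
  let r3 := (1 + / 2 * a * (1 - a) * (5 / 2 + Ti / T)) / A * T in
  r1 * (- 2 / (a * (1 - a ^ 2)) * P) + r3 * ((5 / 2 + Ti / T) / T * P) = P /\
  P * P * A / (a2 * T * (1 + a) * B)
    * (r1 * (a2 * T / P * (1 + 2 / (a * (1 - a))))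
       + r3 * (a2 * (1 + a) / P * (1 - (5 / 2 + Ti / T)))) = - P /\
  P * P * A / (a2 * T * (1 + a) * B)
    * (r1 * (a2 * (3 / 2 * T + Ti)) + r3 * (a2 * (3 / 2 * (1 + a)))) = P * P.
Proof.
  intros Ha2 Ha HT HP HA HB EA EB.
  assert (H1a : 0 < (1 - a) * (1 + a)) by (apply Rmult_lt_0_compat; lra).
  unfold coefA in EA.
  remember (Ti / T) as x eqn:Hx.
  assert (E : Ti = x * T) by (rewrite Hx; field; lra).
  replace (3 * Ti / T) with (3 * x) in EB by (rewrite E; field; lra).
  replace (Ti ^ 2 / T ^ 2) with (x ^ 2) in EB by (rewrite E; field; lra).
  rewrite E. clear E Hx. cbv zeta.
  repeat split; field_simplify_eq; try (rewrite ?EB, ?EA; field); repeat split; lra.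
Qed.

(** The differential system satisfied by a right eigenvector [X] of the
    Lagrangian system v_t - u_xi = 0, u_t + p_xi = 0,
    (e + u^2/2)_t + (p u)_xi = 0 for the eigenvalue [lam]. *)
Definition is_characteristic (a2 Ti kappa : R) (X : state -> state)
    (lam : state -> R) (q : state) : Prop :=
  let v q := volume a2 Ti kappa (deg q) (temp q) in
  let p q := pressure Ti kappa (deg q) (temp q) in
  let E q := energy a2 Ti (deg q) (temp q) + / 2 * vel q ^ 2 in
  - lam q * along X v q - along X vel q = 0 /\
  - lam q * along X vel q + along X p q = 0 /\
  - lam q * along X E q + along X (fun q => p q * vel q) q = 0.

Lemma is_characteristic_pm (a2 Ti kappa : R) (q : state) :
  0 < a2 -> 0 < Ti -> 0 < kappa -> admissible q ->
  is_characteristic a2 Ti kappa (R_plus a2 Ti kappa) (lambda_plus a2 Ti kappa) q /\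
  is_characteristic a2 Ti kappa (R_minus a2 Ti kappa) (lambda_minus a2 Ti kappa) q.
Proof.
  intros Ha2 HTi Hk [Ha HT]. destruct q as [a u T]; simpl in Ha, HT.
  unfold is_characteristic, along, lambda_plus, lambda_minus; simpl.
  pose proof (pressure_pos Ti kappa a T Hk Ha) as Hp.
  pose proof (lambda_sq_pos a2 Ti kappa a T Ha2 HTi Hk Ha HT) as Hl2.
  pose proof (sqrt_lt_R0 _ Hl2) as Hl.
  pose proof (sqrt_sqrt _ (Rlt_le _ _ Hl2)) as Hll.
  fold (lambda a2 Ti kappa a T) in Hl, Hll.
  pose proof (coefA_pos Ti a T Ha) as HA.
  assert (H1a : 0 < (1 - a) * (1 + a)) by (apply Rmult_lt_0_compat; lra).
  pose proof (is_derive_pressure_a Ti kappa a T Hk Ha HT) as Dpa.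
  pose proof (is_derive_pressure_T Ti kappa a T Hk Ha HT) as DpT.
  assert (Epa : Derive (fun b : R => pressure Ti kappa b T) a
     = - 2 / (a * (1 - a ^ 2)) * pressure Ti kappa a T) by exact (is_derive_unique _ _ _ Dpa).
  assert (EpT : Derive (fun S : R => pressure Ti kappa a S) T
     = (5 / 2 + Ti / T) / T * pressure Ti kappa a T) by exact (is_derive_unique _ _ _ DpT).
  assert (Xpa : ex_derive (fun b => pressure Ti kappa b T) a) by (eexists; exact Dpa).
  assert (XpT : ex_derive (fun S => pressure Ti kappa a S) T) by (eexists; exact DpT).
  set (P := pressure Ti kappa a T) in *.
  set (L := lambda a2 Ti kappa a T) in *.
  set (B := 3 / 2 + / 2 * a * (1 - a) * (15 / 4 + 3 * Ti / T + Ti ^ 2 / T ^ 2)).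
  assert (HB : 0 < B).
  { unfold B.
    replace (3 * Ti / T) with (3 * (Ti / T)) by (field; lra).
    replace (Ti ^ 2 / T ^ 2) with ((Ti / T) ^ 2) by (field; lra).
    assert (Hx : 0 < Ti / T) by now apply Rdiv_lt_0_compat.
    assert (0 < a * (1 - a)) by (apply Rmult_lt_0_compat; lra).
    assert (0 < a * (1 - a) * (15 / 4 + 3 * (Ti / T) + (Ti / T) ^ 2)).
    { apply Rmult_lt_0_compat; [assumption|]. pose proof (pow2_ge_0 (Ti / T)). lra. }
    lra. }
  assert (Dva : Derive (fun b => volume a2 Ti kappa b T) a
     = a2 * T / P * (1 + 2 / (a * (1 - a)))).
  { apply is_derive_unique. unfold volume. auto_derive.
    - split; [exact Xpa|]. split; [|exact I]. fold P; lra.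
    - change (pressure Ti kappa a T) with P. rewrite ?Epa.
      field. repeat split; lra. }
  assert (DvT : Derive (fun S => volume a2 Ti kappa a S) T
     = a2 * (1 + a) / P * (1 - (5 / 2 + Ti / T))).
  { apply is_derive_unique. unfold volume. auto_derive.
    - split; [exact XpT|]. split; [|exact I]. fold P; lra.
    - change (pressure Ti kappa a T) with P. rewrite ?EpT.
      field. repeat split; lra. }
  assert (DEa : Derive (fun b => energy a2 Ti b T + / 2 * (u * (u * 1))) a
     = a2 * (3 / 2 * T + Ti)).
  { apply is_derive_unique. unfold energy. auto_derive; [exact I | ring]. }
  assert (DEu : Derive (fun w => energy a2 Ti a T + / 2 * (w * (w * 1))) u = u).
  { apply is_derive_unique. auto_derive; [exact I | field]. }
  assert (DET : Derive (fun S => energy a2 Ti a S + / 2 * (u * (u * 1))) T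
     = a2 * (3 / 2 * (1 + a))).
  { apply is_derive_unique. unfold energy. auto_derive; [exact I | ring]. }
  assert (Du : Derive (fun w => w) u = 1) by apply Derive_id.
  assert (Dpua : Derive (fun b => pressure Ti kappa b T * u) a
     = - 2 / (a * (1 - a ^ 2)) * P * u) by (rewrite <- Epa; apply Derive_scal_l).
  assert (DpuT : Derive (fun S => pressure Ti kappa a S * u) T
     = (5 / 2 + Ti / T) / T * P * u) by (rewrite <- EpT; apply Derive_scal_l).
  assert (Dpuu : Derive (fun w => P * w) u = P)
    by (rewrite Derive_scal, Du; ring).
  rewrite !Derive_const, Du, Dva, DvT, Epa, EpT, DEa, DEu, DET, Dpua, DpuT, Dpuu.
  set (r1 := / 2 * a * (1 - a * (a * 1)) * (Ti / T) / coefA Ti a T).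
  set (r3 := (1 + / 2 * a * (1 - a) * (5 / 2 + Ti / T)) / coefA Ti a T * T).
  assert (HLL : L * L = P * P * coefA Ti a T / (a2 * T * (1 + a) * B)).
  { rewrite Hll. unfold lambda_sq. fold P. fold B. field. repeat split; lra. }
  destruct (characteristic_identities a2 Ti a T P (coefA Ti a T) B)
    as [FP [FV FE]]; try assumption; try reflexivity.
  rewrite <- HLL in FV, FE. fold r1 r3 in FP, FV, FE.
  clearbody r1 r3. clear - FP FV FE Hl.
  set (w := P / L).
  assert (HP : P = L * w) by (unfold w; field; lra).
  clearbody w.
  set (pa := - 2 / (a * (1 - a ^ 2)) * P) in *.
  set (pT := (5 / 2 + Ti / T) / T * P) in *.
  set (va := a2 * T / P * (1 + 2 / (a * (1 - a)))) in *.
  set (vT := a2 * (1 + a) / P * (1 - (5 / 2 + Ti / T))) in *.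
  set (ea := a2 * (3 / 2 * T + Ti)) in *.
  set (eT := a2 * (3 / 2 * (1 + a))) in *.
  clearbody pa pT va vT ea eT.
  rewrite HP in FP, FV, FE. rewrite !HP.
  assert (GV : L * (r1 * va + r3 * vT) = - w)
    by (apply Rmult_eq_reg_l with L; lra).
  assert (GE : r1 * ea + r3 * eT = w * w).
  { apply Rmult_eq_reg_l with (L * L); [lra|].
    apply Rmult_integral_contrapositive; lra. }
  assert (GE' : L * (r1 * ea + r3 * eT) = L * (w * w)) by (rewrite GE; reflexivity).
  assert (GP : (r1 * pa + r3 * pT) * u = L * w * u) by (rewrite FP; reflexivity).
  repeat split; lra.
Qed.

(* Main.v *)
Require Import Defs.
From Stdlib Require Import Reals Lra Ranalysis5 FunctionalExtensionality.
From Coquelicot Require Import Coquelicot.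
Open Scope R_scope.

(** The proof rests on one fact: the pressure satisfies [R_+ . grad p = p].
    Together with [R_+ . grad entropy = 0] it makes the thermodynamic part of
    the characteristic fields explicitly integrable.

    On an isentrope [T = curve_T a] the derivative of [curve_T] is the quotient
    of the temperature component of [R_+] by its [a]-component [deg_speed], so
    [dp/da = p / deg_speed], which is positive: this is the first assertion.
    It also says that, along an integral curve of [R_+], the parameter is the
    logarithm of the pressure up to a constant.

    The logarithm of the pressure maps [(0, alpha_inf)] onto the whole real line
    ([log_pressure_onto]).  Indeed [ln p - 5/2 ln T] increases along the isentrope,
    so [ln p] is controlled by [5/2 ln T] on either side of a reference point,
    while [T] runs from 0 to infinity.  Inverting it ([isentrope_flow])
    therefore gives integral curves of both fields defined for all times
    ([global_integral_curve]); they are maximal, and they cover the isentrope.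

    It remains to find which part of the isentrope is the rarefaction curve.
    An integral curve starting at the given state stays on the isentrope,
    and [a] increases along [R_+] and decreases along [R_-].  At the initial
    state [lam] has positive derivative along the field, so [lam] can only
    increase away from it in forward time: the rarefaction
    curve stays on one side of [a0].  Conversely, [lam] increases for all forward
    time by a continuation argument ([increasing_continuation]): as long as it has
    increased, the point reached lies on the rarefaction curve, where
    [R . grad lam > 0] by assumption, and by continuity of this quantity the
    growth goes on a little longer.  The two families are treated at once, with
    a sign [sg] equal to 1 or -1. *)

(** * Monotone functions of one real variable *)

Lemma derive_pos_increasing (f f' : R -> R) (lo hi : Rbar) :
  (forall x : R, in_itv lo hi x -> is_derive f x (f' x) /\ 0 < f' x) ->
  forall x y : R, Rbar_lt lo x -> x < y -> Rbar_lt y hi -> f x < f y.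
Proof.
  intros H. apply (incr_function f lo hi f'); intros x Hl Hh; now apply H.
Qed.

Lemma derive_pos_left (f : R -> R) (x d : R) :
  is_derive f x d -> 0 < d ->
  exists e : posreal, forall y, x - e < y < x -> f y < f x.
Proof.
  intros Hf Hd. apply is_derive_Reals in Hf.
  destruct (Hf d Hd) as [e He]. exists e. intros y Hy.
  specialize (He (y - x) ltac:(lra) ltac:(rewrite Rabs_left; lra)).
  replace (x + (y - x)) with y in He by ring.
  apply Rabs_def2 in He.
  assert (E : f y - f x = (f y - f x) / (y - x) * (y - x)) by (field; lra).
  set (q := _ / _) in E, He.
  assert (0 < q * (x - y)) by (apply Rmult_lt_0_compat; lra).
  lra.
Qed.

(** The derivative is positive at time 0, and the set of times up to which it is
    positive is open by continuity and closed by the assumption: at its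
    supremum [m], [f] has increased on [[0, m]], hence [f' m > 0]. *)
Lemma increasing_continuation (f f' : R -> R) :
  (forall t, is_derive f t (f' t)) -> (forall t, continuous f' t) ->
  (forall t, 0 <= t -> (forall r1 r2, 0 <= r1 < r2 -> r2 <= t -> f r1 < f r2) ->
     0 < f' t) ->
  forall r1 r2, 0 <= r1 < r2 -> f r1 < f r2.
Proof.
  intros Df Cf Hloc.
  assert (Hinc : forall t, (forall r, 0 <= r < t -> 0 < f' r) ->
            forall r1 r2, 0 <= r1 < r2 -> r2 <= t -> f r1 < f r2).
  { intros t Ht r1 r2 H1 H2.
    destruct (MVT_cor2 f f' r1 r2) as [c [E Hc]]; [lra | |].
    - intros c _. now apply is_derive_Reals.
    - assert (0 < f' c * (r2 - r1)) by (apply Rmult_lt_0_compat; [apply Ht|]; lra).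
      lra. }
  enough (Hpos : forall t, 0 <= t -> 0 < f' t).
  { intros r1 r2 H. apply (Hinc r2); [|lra|lra]. intros r Hr. apply Hpos; lra. }
  intros s Hs. destruct (Rlt_or_le 0 (f' s)) as [H|Hneg]; [exact H|exfalso].
  pose (E := fun t => 0 <= t /\ forall r, 0 <= r <= t -> 0 < f' r).
  destruct (completeness E) as [m [Hub Hlub]].
  - exists s. intros t [_ Ht]. destruct (Rle_or_lt t s) as [|Hts]; [assumption|].
    specialize (Ht s). lra.
  - exists 0. split; [lra|]. intros r Hr. replace r with 0 by lra.
    apply Hloc; intros; lra.
  - assert (E0 : E 0).
    { split; [lra|]. intros r Hr. replace r with 0 by lra. apply Hloc; intros; lra. }
    assert (Hm : 0 <= m) by now apply Hub.
    assert (Hbelow : forall r, 0 <= r < m -> 0 < f' r).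
    { intros r Hr. destruct (Rlt_or_le 0 (f' r)) as [H|H]; [exact H|exfalso].
      enough (m <= r) by lra. apply Hlub. intros t [_ Ht].
      destruct (Rle_or_lt t r) as [|Htr]; [assumption|]. specialize (Ht r); lra. }
    assert (Hfm : 0 < f' m) by (apply Hloc; [lra | now apply Hinc]).
    destruct (proj1 (filterlim_locally _ _) (Cf m) (mkposreal _ Hfm)) as [e He].
    pose proof (cond_pos e).
    assert (Em : E (m + e / 2)).
    { split; [lra|]. intros r Hr. destruct (Rlt_or_le r m) as [|Hrm]; [apply Hbelow; lra|].
      assert (B : ball (f' m) (f' m) (f' r)).
      { apply He. unfold ball; simpl. unfold AbsRing_ball, abs, minus, plus, opp; simpl.
        rewrite Rabs_right; lra. }
      unfold ball in B; simpl in B. unfold AbsRing_ball, abs, minus, plus, opp in B; simpl in B.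
      apply Rabs_def2 in B. lra. }
    apply Hub in Em. lra.
Qed.

(** Monotonicity of [f] forces the right inverse to be increasing and
    continuous, so that the local inverse function theorem applies. *)
Lemma is_derive_right_inverse (f f' h : R -> R) (lo hi : R) :
  (forall x, lo < x < hi -> is_derive f x (f' x) /\ 0 < f' x) ->
  (forall s, lo < h s < hi /\ f (h s) = s) ->
  forall s, is_derive h s (/ f' (h s)).
Proof.
  intros Df Hh s.
  assert (Finc : forall x y, lo < x -> x < y -> y < hi -> f x < f y)
    by (apply (derive_pos_increasing f f' lo hi); exact Df).
  assert (Hinc : forall r t, r < t -> h r < h t).
  { intros r t Hrt. destruct (Hh r) as [Hr Er], (Hh t) as [Ht Et].
    destruct (Rtotal_order (h r) (h t)) as [H|[H|H]]; [exact H| |].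
    - rewrite H in Er. lra.
    - assert (f (h t) < f (h r)) by (apply Finc; lra). lra. }
  assert (Hsand : forall y, lo < y < hi -> forall r, f y < r -> y < h r).
  { intros y Hy r Hr. destruct (Hh r) as [Hr' Er].
    destruct (Rlt_or_le y (h r)) as [|[H|H]]; [assumption| |].
    - assert (f (h r) < f y) by (apply Finc; lra). lra.
    - rewrite <- H in Hr. lra. }
  assert (Hsand' : forall y, lo < y < hi -> forall r, r < f y -> h r < y).
  { intros y Hy r Hr. destruct (Hh r) as [Hr' Er].
    destruct (Rlt_or_le (h r) y) as [|[H|H]]; [assumption| |].
    - assert (f y < f (h r)) by (apply Finc; lra). lra.
    - rewrite H in Hr. lra. }
  assert (Hcont : continuity_pt h s).
  { destruct (Hh s) as [Hs Es].
    intros eps Heps.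
    pose (y1 := Rmax (h s - eps / 2) ((lo + h s) / 2)).
    pose (y2 := Rmin (h s + eps / 2) ((hi + h s) / 2)).
    assert (H1 : lo < y1 < h s /\ h s - eps < y1).
    { unfold y1. apply Rmax_case_strong; lra. }
    assert (H2 : h s < y2 < hi /\ y2 < h s + eps).
    { unfold y2. apply Rmin_case_strong; lra. }
    assert (F1 : f y1 < s) by (rewrite <- Es; apply Finc; lra).
    assert (F2 : s < f y2) by (rewrite <- Es; apply Finc; lra).
    exists (Rmin (s - f y1) (f y2 - s)). split.
    - apply Rmin_case; lra.
    - intros x [_ Hx]. simpl in Hx |- *. unfold R_dist in *.
      pose proof (Rmin_l (s - f y1) (f y2 - s)).
      pose proof (Rmin_r (s - f y1) (f y2 - s)).
      apply Rabs_def2 in Hx.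
      assert (y1 < h x) by (apply Hsand; lra).
      assert (h x < y2) by (apply Hsand'; lra).
      apply Rabs_def1; lra. }
  assert (Pf : forall a, h (s - 1) <= a <= h (s + 1) -> derivable_pt f a).
  { intros a Ha. apply ex_derive_Reals_0. exists (f' a). apply Df.
    destruct (Hh (s - 1)), (Hh (s + 1)). lra. }
  assert (Hs1 : h (s - 1) <= h s <= h (s + 1)).
  { split; apply Rlt_le, Hinc; lra. }
  assert (Ed : derive_pt f (h s) (Pf (h s) Hs1) = f' (h s)).
  { apply derive_pt_eq, is_derive_Reals, Df, Hh. }
  destruct (Df (h s) (proj1 (Hh s))) as [_ Hpos].
  apply is_derive_Reals. rewrite <- (Rmult_1_l (/ _)), <- Ed.
  apply (derivable_pt_lim_recip_interv f h (s - 1) (s + 1) s Pf Hcont); try lra.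
  intros x _. apply Hh.
Qed.

(** * Gradients of the thermodynamic functions *)

(** Differentiability is required along every differentiable curve through the
    point, that is, as the chain rule.  The coordinate lines give back the
    partial derivatives, and each explicit formula can be differentiated as a
    function of one variable. *)
Definition has_gradient (f : R -> R -> R) (a T fa fT : R) : Prop :=
  forall (al th : R -> R) (s da dT : R),
    al s = a -> th s = T -> is_derive al s da -> is_derive th s dT ->
    is_derive (fun r => f (al r) (th r)) s (fa * da + fT * dT).

Lemma has_gradient_partials (f : R -> R -> R) (a T fa fT : R) :
  has_gradient f a T fa fT ->
  Derive (fun b => f b T) a = fa /\ Derive (fun S => f a S) T = fT.
Proof.
  intros H. split; apply is_derive_unique.
  - replace fa with (fa * 1 + fT * 0) by ring.
    apply (H (fun b => b) (fun _ => T)); try reflexivity;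
      [apply (is_derive_id (K := R_AbsRing)) | apply (is_derive_const (K := R_AbsRing) (V := R_NormedModule))].
  - replace fT with (fa * 0 + fT * 1) by ring.
    apply (H (fun _ => a) (fun S => S)); try reflexivity;
      [apply (is_derive_const (K := R_AbsRing) (V := R_NormedModule)) | apply (is_derive_id (K := R_AbsRing))].
Qed.

(** Names the derivatives of the two components of the curve, so that the
    computed derivative of an explicit formula can be compared with the expected
    linear form by algebra alone. *)
Ltac start_gradient :=
  let al := fresh "al" in let th := fresh "th" in let s := fresh "s" in
  let Da := fresh "Da" in let DT := fresh "DT" in
  intros al th s da dT <- <- Da DT;
  assert (ex_derive al s) by (eexists; exact Da);
  assert (ex_derive th s) by (eexists; exact DT);
  auto_derive;
  [| change (Derive (fun x => al x) s) with (Derive al s);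
     change (Derive (fun x => th x) s) with (Derive th s);
     rewrite (is_derive_unique _ _ _ Da), (is_derive_unique _ _ _ DT)].

(** With [coefB], the denominator of [lambda_sq] is [a2 * T * (1 + a) * coefB]. *)
Definition ioniz_C (Ti T : R) : R := 15 / 4 + 3 * Ti / T + Ti ^ 2 / T ^ 2.

Definition coefB (Ti a T : R) : R := 3 / 2 + / 2 * a * (1 - a) * ioniz_C Ti T.

(** [deg_speed] and [temp_speed] are the [a]- and [T]-components of [R_plus]. *)
Definition deg_speed (Ti a T : R) : R :=
  / 2 * a * (1 - a ^ 2) * (Ti / T) / coefA Ti a T.

Definition temp_speed (Ti a T : R) : R :=
  (1 + / 2 * a * (1 - a) * (5 / 2 + Ti / T)) / coefA Ti a T * T.

Lemma coefB_pos (Ti a T : R) : 0 < Ti -> 0 < a < 1 -> 0 < T -> 0 < coefB Ti a T.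
Proof.
  intros HTi Ha HT. unfold coefB, ioniz_C.
  replace (3 * Ti / T) with (3 * (Ti / T)) by (field; lra).
  replace (Ti ^ 2 / T ^ 2) with ((Ti / T) ^ 2) by (field; lra).
  assert (0 < Ti / T) by now apply Rdiv_lt_0_compat.
  assert (0 < a * (1 - a)) by nra. pose proof (pow2_ge_0 (Ti / T)).
  assert (0 < a * (1 - a) * (15 / 4 + 3 * (Ti / T) + (Ti / T) ^ 2))
    by (apply Rmult_lt_0_compat; lra).
  lra.
Qed.

Lemma deg_speed_pos (Ti a T : R) : 0 < Ti -> 0 < a < 1 -> 0 < T -> 0 < deg_speed Ti a T.
Proof.
  intros HTi Ha HT. unfold deg_speed.
  assert (0 < Ti / T) by now apply Rdiv_lt_0_compat.
  apply Rdiv_lt_0_compat; [|now apply coefA_pos].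
  repeat apply Rmult_lt_0_compat; nra.
Qed.

Lemma pressure_gradient (Ti kappa a T : R) :
  0 < kappa -> 0 < a < 1 -> 0 < T ->
  has_gradient (pressure Ti kappa) a T
    (pressure Ti kappa a T * (- 2 / (a * (1 - a ^ 2))))
    (pressure Ti kappa a T * ((5 / 2 + Ti / T) / T)).
Proof.
  intros Hk Ha HT. unfold pressure, Rpower.
  assert (0 < (1 - a) * (1 + a)) by (apply Rmult_lt_0_compat; lra).
  start_gradient.
  - repeat split; try assumption; try lra. apply Rmult_integral_contrapositive; lra.
  - change (- Ti * / th s) with (- Ti / th s). field. repeat split; lra.
Qed.

Lemma coefA_gradient (Ti a T : R) :
  0 < T ->
  has_gradient (coefA Ti) a T
    (/ 2 * (1 - 2 * a) * (5 / 2 + Ti / T) ^ 2)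
    (- a * (1 - a) * (5 / 2 + Ti / T) * Ti / T ^ 2).
Proof.
  intros HT. unfold coefA. start_gradient.
  - repeat split; try assumption; lra.
  - field. lra.
Qed.

Lemma coefB_gradient (Ti a T : R) :
  0 < T ->
  has_gradient (coefB Ti) a T
    (/ 2 * (1 - 2 * a) * ioniz_C Ti T)
    (- / 2 * a * (1 - a) * (3 * Ti / T ^ 2 + 2 * Ti ^ 2 / T ^ 3)).
Proof.
  intros HT. unfold coefB, ioniz_C. start_gradient.
  - repeat split; try assumption; try lra. repeat apply Rmult_integral_contrapositive_currified; lra.
  - field. lra.
Qed.

Lemma entropy_gradient (Ti a T : R) :
  0 < a < 1 -> 0 < T ->
  has_gradient (entropy Ti) a T
    (2 / (a * (1 - a)) + (5 / 2 + Ti / T)) (- Ti * (1 + a) / T ^ 2).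
Proof.
  intros Ha HT. unfold entropy. start_gradient.
  - repeat split; try assumption; try lra. apply Rdiv_lt_0_compat; lra.
  - field. repeat split; lra.
Qed.

(** The partial derivatives of [ln lambda].  Since
    [lambda = p sqrt (coefA / (a2 T (1 + a) coefB))], they are rational functions
    of [a] and [T] and contain neither the exponential nor the square root; this
    makes their continuity along curves immediate. *)
Definition log_lambda_a (Ti a T : R) : R :=
  - 2 / (a * (1 - a ^ 2))
  + / 2 * (/ 2 * (1 - 2 * a) * (5 / 2 + Ti / T) ^ 2 / coefA Ti a T
           - / (1 + a) - / 2 * (1 - 2 * a) * ioniz_C Ti T / coefB Ti a T).

Definition log_lambda_T (Ti a T : R) : R :=
  (5 / 2 + Ti / T) / T
  + / 2 * (- a * (1 - a) * (5 / 2 + Ti / T) * Ti / T ^ 2 / coefA Ti a T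
           - / T + / 2 * a * (1 - a) * (3 * Ti / T ^ 2 + 2 * Ti ^ 2 / T ^ 3) / coefB Ti a T).

Lemma lambda_gradient (a2 Ti kappa a T : R) :
  0 < a2 -> 0 < Ti -> 0 < kappa -> 0 < a < 1 -> 0 < T ->
  has_gradient (lambda a2 Ti kappa) a T
    (lambda a2 Ti kappa a T * log_lambda_a Ti a T)
    (lambda a2 Ti kappa a T * log_lambda_T Ti a T).
Proof.
  intros Ha2 HTi Hk Ha HT al th s da dT E1 E2 Da DT.
  pose proof (pressure_gradient Ti kappa a T Hk Ha HT al th s da dT E1 E2 Da DT) as DP.
  pose proof (coefA_gradient Ti a T HT al th s da dT E1 E2 Da DT) as DA.
  pose proof (coefB_gradient Ti a T HT al th s da dT E1 E2 Da DT) as DB.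
  pose proof (lambda_sq_pos a2 Ti kappa a T Ha2 HTi Hk Ha HT) as HL.
  pose proof (sqrt_lt_R0 _ HL) as Hl.
  pose proof (sqrt_sqrt _ (Rlt_le _ _ HL)) as Hll.
  pose proof (pressure_pos Ti kappa a T Hk Ha) as HP.
  pose proof (coefA_pos Ti a T Ha) as HA.
  pose proof (coefB_pos Ti a T HTi Ha HT) as HB.
  set (w := log_lambda_a Ti a T * da + log_lambda_T Ti a T * dT).
  assert (DL : is_derive (fun r => lambda_sq a2 Ti kappa (al r) (th r)) s
            (2 * lambda_sq a2 Ti kappa a T * w)).
  { unfold lambda_sq at 1.
    change (is_derive (fun r => (pressure Ti kappa (al r) (th r)) ^ 2 * coefA Ti (al r) (th r)
       / (a2 * th r * (1 + al r) * coefB Ti (al r) (th r))) s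
            (2 * lambda_sq a2 Ti kappa a T * w)).
    change (lambda_sq a2 Ti kappa a T) with
      (pressure Ti kappa a T ^ 2 * coefA Ti a T / (a2 * T * (1 + a) * coefB Ti a T)).
    set (fP := fun r => pressure Ti kappa (al r) (th r)) in *.
    set (fA := fun r => coefA Ti (al r) (th r)) in *.
    set (fB := fun r => coefB Ti (al r) (th r)) in *.
    assert (EP : fP s = pressure Ti kappa a T) by (unfold fP; now rewrite E1, E2).
    assert (EA : fA s = coefA Ti a T) by (unfold fA; now rewrite E1, E2).
    assert (EB : fB s = coefB Ti a T) by (unfold fB; now rewrite E1, E2).
    change (is_derive (fun r => (fP r) ^ 2 * fA r / (a2 * th r * (1 + al r) * fB r)) s
      (2 * (pressure Ti kappa a T ^ 2 * coefA Ti a T / (a2 * T * (1 + a) * coefB Ti a T)) * w)).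
    change (is_derive fP s (pressure Ti kappa a T * (- 2 / (a * (1 - a ^ 2))) * da
      + pressure Ti kappa a T * ((5 / 2 + Ti / T) / T) * dT)) in DP.
    change (is_derive fA s (/ 2 * (1 - 2 * a) * (5 / 2 + Ti / T) ^ 2 * da
      + - a * (1 - a) * (5 / 2 + Ti / T) * Ti / T ^ 2 * dT)) in DA.
    change (is_derive fB s (/ 2 * (1 - 2 * a) * ioniz_C Ti T * da
      + - / 2 * a * (1 - a) * (3 * Ti / T ^ 2 + 2 * Ti ^ 2 / T ^ 3) * dT)) in DB.
    clearbody fP fA fB.
    (* [pressure], [coefA] and [coefB] are now opaque functions of the parameter *)
    auto_derive.
    - repeat split; [eexists; exact DP | eexists; exact DA | eexists; exact DT | eexists; exact Da | eexists; exact DB |].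
      rewrite E1, E2, EB. repeat apply Rmult_integral_contrapositive_currified; lra.
    - change (Derive (fun x => al x) s) with (Derive al s).
      change (Derive (fun x => th x) s) with (Derive th s).
      change (Derive (fun x => fP x) s) with (Derive fP s).
      change (Derive (fun x => fA x) s) with (Derive fA s).
      change (Derive (fun x => fB x) s) with (Derive fB s).
      rewrite (is_derive_unique _ _ _ Da), (is_derive_unique _ _ _ DT),
        (is_derive_unique _ _ _ DP), (is_derive_unique _ _ _ DA), (is_derive_unique _ _ _ DB).
      rewrite E1, E2, EB, EA, EP. unfold w, log_lambda_a, log_lambda_T.
      assert (0 < (1 - a) * (1 + a)) by (apply Rmult_lt_0_compat; lra).
      generalize (ioniz_C Ti T); intro C.
      set (A := coefA Ti a T) in *. set (B := coefB Ti a T) in *.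
      set (P := pressure Ti kappa a T) in *. clearbody A B P.
      field. repeat split; lra. }
  assert (Els : lambda_sq a2 Ti kappa (al s) (th s) = lambda_sq a2 Ti kappa a T)
    by now rewrite E1, E2.
  pose proof (is_derive_sqrt _ _ _ DL) as DS. cbv beta in DS. rewrite Els in DS.
  specialize (DS HL).
  replace (_ + _) with (2 * lambda_sq a2 Ti kappa a T * w / (2 * sqrt (lambda_sq a2 Ti kappa a T))).
  - exact DS.
  - rewrite <- Hll at 1. unfold lambda, w. field. lra.
Qed.

(** * The isentrope and the pressure along it *)

(** This is [R_+ . grad p = p], divided by [p]. *)
Lemma characteristic_pressure (Ti a T : R) :
  0 < a < 1 -> 0 < T ->
  - 2 / (a * (1 - a ^ 2)) * deg_speed Ti a T
    + (5 / 2 + Ti / T) / T * temp_speed Ti a T = 1.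
Proof.
  intros Ha HT. pose proof (coefA_pos Ti a T Ha) as HA. unfold deg_speed, temp_speed.
  assert (0 < (1 - a) * (1 + a)) by (apply Rmult_lt_0_compat; lra).
  remember (coefA Ti a T) as A eqn:EA. unfold coefA in EA.
  field_simplify_eq; [rewrite EA; field | repeat split]; lra.
Qed.

(** The entropy is a Riemann invariant of [R_+] and [R_-]. *)
Lemma characteristic_entropy (Ti a T : R) :
  0 < a < 1 -> 0 < T ->
  (2 / (a * (1 - a)) + (5 / 2 + Ti / T)) * deg_speed Ti a T
    + - Ti * (1 + a) / T ^ 2 * temp_speed Ti a T = 0.
Proof.
  intros Ha HT. pose proof (coefA_pos Ti a T Ha). unfold deg_speed, temp_speed.
  field. repeat split; lra.
Qed.

Lemma curve_den_pos (eta0 ainf a : R) :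
  is_alpha_inf eta0 ainf -> 0 < a < ainf -> 0 < curve_den eta0 a.
Proof.
  intros [[H1 H2] _] Ha. rewrite <- H2. apply curve_den_decr; lra.
Qed.

(** The denominator decreases through its zero [ainf], so it is positive only to
    the left of it. *)
Lemma lt_alpha_inf (eta0 ainf a : R) :
  is_alpha_inf eta0 ainf -> 0 < a < 1 -> 0 < curve_den eta0 a -> a < ainf.
Proof.
  intros [[H1 H2] _] Ha Hd. destruct (Rtotal_order a ainf) as [H|[->|H]]; [exact H|lra|].
  pose proof (curve_den_decr eta0 ainf a). lra.
Qed.

Lemma alpha_inf_bounds (eta0 ainf a : R) :
  is_alpha_inf eta0 ainf -> 0 < a < ainf -> 0 < a < 1.
Proof. intros [[H1 _] _] Ha. lra. Qed.

Lemma curve_T_pos (Ti eta0 ainf a : R) :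
  0 < Ti -> is_alpha_inf eta0 ainf -> 0 < a < ainf -> 0 < curve_T Ti eta0 a.
Proof.
  intros HTi Hi Ha. unfold curve_T. apply Rdiv_lt_0_compat; [nra|].
  now apply curve_den_pos with ainf.
Qed.

Lemma entropy_curve_den (Ti a T : R) :
  0 < T -> curve_den (entropy Ti a T) a = (1 + a) * Ti / T.
Proof. intros HT. unfold curve_den, entropy. field. lra. Qed.

(** At entropy [eta0] the denominator of [curve_T] equals [(1 + a) Ti / T], which
    is positive and determines [T]. *)
Lemma isentrope_is_graph (Ti eta0 ainf a T : R) :
  0 < Ti -> is_alpha_inf eta0 ainf -> 0 < a < 1 -> 0 < T -> entropy Ti a T = eta0 ->
  0 < a < ainf /\ T = curve_T Ti eta0 a.
Proof.
  intros HTi Hi Ha HT <-. pose proof (entropy_curve_den Ti a T HT) as E. split.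
  - split; [lra|]. apply (lt_alpha_inf _ _ _ Hi Ha). rewrite E.
    apply Rdiv_lt_0_compat; nra.
  - unfold curve_T. rewrite E. field. nra.
Qed.

(** The tangent of the isentrope is parallel to [(deg_speed, temp_speed)]. *)
Lemma is_derive_curve_T (Ti eta0 ainf a : R) :
  0 < Ti -> is_alpha_inf eta0 ainf -> 0 < a < ainf ->
  is_derive (curve_T Ti eta0) a
    (temp_speed Ti a (curve_T Ti eta0 a) / deg_speed Ti a (curve_T Ti eta0 a)).
Proof.
  intros HTi Hi Ha. pose proof (alpha_inf_bounds _ _ _ Hi Ha) as Ha1.
  pose proof (curve_den_pos _ _ _ Hi Ha) as HD.
  pose proof (curve_T_pos _ _ _ _ HTi Hi Ha) as HT.
  pose proof (coefA_pos Ti a (curve_T Ti eta0 a) Ha1) as HA.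
  replace (_ / _) with (Ti / curve_den eta0 a
      + (1 + a) * Ti * (2 / (a * (1 - a)) + 5 / 2) / curve_den eta0 a ^ 2).
  - unfold curve_T. unfold curve_den in *. auto_derive.
    + change (1 + - a) with (1 - a). repeat split; try lra.
      apply Rdiv_lt_0_compat; lra.
    + change (1 + - a) with (1 - a). set (l := ln _) in *.
      assert (HD' : (1 + 1) * l - 5 / 2 * (1 + a) + eta0 <> 0) by lra.
      field. repeat split; lra.
  - unfold deg_speed, temp_speed. set (A := coefA _ _ _) in *. clearbody A.
    unfold curve_T in *. set (D := curve_den eta0 a) in *. clearbody D.
    field. assert (0 < (1 - a) * (1 + a)) by (apply Rmult_lt_0_compat; lra).
    repeat split; lra.
Qed.

(** Parametrized by [a], the isentrope has tangent [R_+ / deg_speed], along which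
    [p] has derivative [p / deg_speed]. *)
Lemma is_derive_pressure_curve (Ti kappa eta0 ainf a : R) :
  0 < Ti -> 0 < kappa -> is_alpha_inf eta0 ainf -> 0 < a < ainf ->
  is_derive (fun b => pressure Ti kappa b (curve_T Ti eta0 b)) a
    (pressure Ti kappa a (curve_T Ti eta0 a) / deg_speed Ti a (curve_T Ti eta0 a)).
Proof.
  intros HTi Hk Hi Ha. pose proof (alpha_inf_bounds _ _ _ Hi Ha) as Ha1.
  pose proof (curve_T_pos _ _ _ _ HTi Hi Ha) as HT.
  pose proof (is_derive_curve_T _ _ _ _ HTi Hi Ha) as DT.
  pose proof (deg_speed_pos Ti _ _ HTi Ha1 HT) as Hr.
  pose proof (characteristic_pressure Ti _ _ Ha1 HT) as E.
  pose proof (pressure_gradient Ti kappa a (curve_T Ti eta0 a) Hk Ha1 HT (fun b => b)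
    (curve_T Ti eta0) a _ _ eq_refl eq_refl (is_derive_id (K := R_AbsRing) a) DT) as D.
  set (T := curve_T Ti eta0 a) in *.
  replace (pressure Ti kappa a T / deg_speed Ti a T) with
    (pressure Ti kappa a T * (- 2 / (a * (1 - a ^ 2))) * 1
     + pressure Ti kappa a T * ((5 / 2 + Ti / T) / T)
       * (temp_speed Ti a T / deg_speed Ti a T)); [exact D|].
  apply Rmult_eq_reg_r with (deg_speed Ti a T); [|lra].
  transitivity (pressure Ti kappa a T *
    (- 2 / (a * (1 - a ^ 2)) * deg_speed Ti a T
    + (5 / 2 + Ti / T) / T * temp_speed Ti a T)).
  - set (c1 := - 2 / _). set (c2 := _ / T). field. lra.
  - rewrite E. field. lra.
Qed.

Definition log_pressure (Ti kappa eta0 a : R) : R :=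
  ln (pressure Ti kappa a (curve_T Ti eta0 a)).

Lemma is_derive_log_pressure (Ti kappa eta0 ainf a : R) :
  0 < Ti -> 0 < kappa -> is_alpha_inf eta0 ainf -> 0 < a < ainf ->
  is_derive (log_pressure Ti kappa eta0) a (/ deg_speed Ti a (curve_T Ti eta0 a)).
Proof.
  intros HTi Hk Hi Ha. pose proof (alpha_inf_bounds _ _ _ Hi Ha) as Ha1.
  pose proof (curve_T_pos _ _ _ _ HTi Hi Ha) as HT.
  pose proof (pressure_pos Ti kappa a (curve_T Ti eta0 a) Hk Ha1) as HP.
  pose proof (deg_speed_pos Ti _ _ HTi Ha1 HT) as Hr.
  pose proof (is_derive_comp ln _ a _ _ (is_derive_ln _ HP)
    (is_derive_pressure_curve _ _ _ _ _ HTi Hk Hi Ha)) as D.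
  unfold log_pressure.
  replace (/ deg_speed Ti a (curve_T Ti eta0 a)) with
    (scal (pressure Ti kappa a (curve_T Ti eta0 a) / deg_speed Ti a (curve_T Ti eta0 a))
       (/ pressure Ti kappa a (curve_T Ti eta0 a))); [exact D|].
  unfold scal; simpl; unfold mult; simpl. field. lra.
Qed.

Lemma log_pressure_increasing (Ti kappa eta0 ainf a b : R) :
  0 < Ti -> 0 < kappa -> is_alpha_inf eta0 ainf -> 0 < a -> a < b -> b < ainf ->
  log_pressure Ti kappa eta0 a < log_pressure Ti kappa eta0 b.
Proof.
  intros HTi Hk Hi Ha Hab Hb.
  apply (derive_pos_increasing (log_pressure Ti kappa eta0)
    (fun c => / deg_speed Ti c (curve_T Ti eta0 c)) 0 ainf); try assumption.
  intros c Hc. change (0 < c < ainf) in Hc. split.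
  - now apply is_derive_log_pressure with ainf.
  - apply Rinv_0_lt_compat, deg_speed_pos; [assumption | |].
    + now apply (alpha_inf_bounds eta0 ainf).
    + now apply (curve_T_pos _ _ ainf).
Qed.

Lemma log_pressure_inj (Ti kappa eta0 ainf a b : R) :
  0 < Ti -> 0 < kappa -> is_alpha_inf eta0 ainf -> 0 < a < ainf -> 0 < b < ainf ->
  log_pressure Ti kappa eta0 a = log_pressure Ti kappa eta0 b -> a = b.
Proof.
  intros HTi Hk Hi Ha Hb E.
  assert (Linc : forall x y, 0 < x -> x < y -> y < ainf ->
    log_pressure Ti kappa eta0 x < log_pressure Ti kappa eta0 y)
    by (intros x y; now apply log_pressure_increasing).
  destruct (Rtotal_order a b) as [H|[H|H]]; [|exact H|].
  - pose proof (Linc a b). lra.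
  - pose proof (Linc b a). lra.
Qed.

(** With [w = 5/2 + Ti/T] and [m = a (1 - a) / 2], the derivative of [ln T] with
    respect to [ln p] is [(1 + m w) / (5/2 + m w^2)], which is less than 2/5
    because [w > 5/2].  Expressed in terms of [a], the gap is [w / (1 + a)].
    Thus [p] dominates a multiple of [T^(5/2)] to the right of a point and is
    dominated by one to the left, without asymptotic expansions. *)
Lemma log_pressure_minus_T_increasing (Ti kappa eta0 ainf a b : R) :
  0 < Ti -> 0 < kappa -> is_alpha_inf eta0 ainf -> 0 < a -> a < b -> b < ainf ->
  log_pressure Ti kappa eta0 a - 5 / 2 * ln (curve_T Ti eta0 a)
  < log_pressure Ti kappa eta0 b - 5 / 2 * ln (curve_T Ti eta0 b).
Proof.
  intros HTi Hk Hi Ha Hab Hb.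
  apply (derive_pos_increasing
    (fun c => log_pressure Ti kappa eta0 c - 5 / 2 * ln (curve_T Ti eta0 c))
    (fun c => (5 / 2 + Ti / curve_T Ti eta0 c) / (1 + c)) 0 ainf); try assumption.
  intros c Hc. change (0 < c < ainf) in Hc.
  pose proof (alpha_inf_bounds _ _ _ Hi Hc) as Hc1.
  pose proof (curve_T_pos _ _ _ _ HTi Hi Hc) as HT.
  pose proof (is_derive_curve_T _ _ _ _ HTi Hi Hc) as DT.
  pose proof (is_derive_log_pressure _ kappa _ _ _ HTi Hk Hi Hc) as DL.
  split.
  - auto_derive.
    + repeat split; [eexists; exact DL | eexists; exact DT | exact HT].
    + change (Derive (fun x => log_pressure Ti kappa eta0 x) c)
        with (Derive (log_pressure Ti kappa eta0) c).
      change (Derive (fun x => curve_T Ti eta0 x) c) with (Derive (curve_T Ti eta0) c).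
      rewrite (is_derive_unique _ _ _ DT), (is_derive_unique _ _ _ DL).
      unfold deg_speed, temp_speed. set (T := curve_T Ti eta0 c) in *. clearbody T.
      pose proof (coefA_pos Ti c T Hc1) as HA.
      assert (0 < (1 - c) * (1 + c)) by (apply Rmult_lt_0_compat; lra).
      remember (coefA Ti c T) as A eqn:EA. unfold coefA in EA.
      field_simplify_eq; [rewrite EA; field | repeat split]; lra.
  - assert (0 < Ti / curve_T Ti eta0 c) by now apply Rdiv_lt_0_compat.
    apply Rdiv_lt_0_compat; lra.
Qed.

(** The level [d] of the denominator at [eta0] is its zero at [eta0 - d]. *)
Lemma curve_den_onto (eta0 ainf d : R) :
  is_alpha_inf eta0 ainf -> 0 < d -> exists a, 0 < a < ainf /\ curve_den eta0 a = d.
Proof.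
  intros Hi Hd. destruct (alpha_inf_exists (eta0 - d)) as [a [[Ha E] _]].
  assert (E' : curve_den eta0 a = d) by (unfold curve_den in *; lra).
  exists a. split; [|exact E']. split; [lra|].
  apply (lt_alpha_inf _ _ _ Hi Ha). lra.
Qed.

(** Since [1 < 1 + a < 2], the temperature lies between [Ti / d] and [2 Ti / d]
    where the denominator is [d]; hence [T] is large where [d] is small, and
    small where [d] is large. *)
Lemma curve_T_unbounded (Ti eta0 ainf a0 M : R) :
  0 < Ti -> is_alpha_inf eta0 ainf -> 0 < a0 < ainf ->
  exists a, a0 < a < ainf /\ M < ln (curve_T Ti eta0 a).
Proof.
  intros HTi Hi Ha0. pose proof (curve_den_pos _ _ _ Hi Ha0) as HD0.
  pose proof (exp_pos M) as HM.
  set (d := Rmin (curve_den eta0 a0 / 2) (Ti / exp M)).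
  assert (Hd : 0 < d).
  { unfold d. apply Rmin_case; [lra|]. now apply Rdiv_lt_0_compat. }
  destruct (curve_den_onto eta0 ainf d Hi Hd) as [a [Ha E]].
  assert (d <= curve_den eta0 a0 / 2) by apply Rmin_l.
  assert (Hd2 : d <= Ti / exp M) by apply Rmin_r.
  pose proof (alpha_inf_bounds _ _ _ Hi Ha0). pose proof (alpha_inf_bounds _ _ _ Hi Ha).
  exists a. split.
  - split; [|lra]. destruct (Rlt_or_le a0 a) as [|[H'|H']]; [assumption| |subst; lra].
    pose proof (curve_den_decr eta0 a a0). lra.
  - rewrite <- (ln_exp M). apply ln_increasing; [exact HM|].
    unfold curve_T. rewrite E. apply Rlt_div_r; [exact Hd|].
    assert (exp M * d <= exp M * (Ti / exp M)) by (apply Rmult_le_compat_l; lra).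
    replace (exp M * (Ti / exp M)) with Ti in * by (field; lra). nra.
Qed.

Lemma curve_T_vanishes (Ti eta0 ainf a0 M : R) :
  0 < Ti -> is_alpha_inf eta0 ainf -> 0 < a0 < ainf ->
  exists a, 0 < a < a0 /\ ln (curve_T Ti eta0 a) < M.
Proof.
  intros HTi Hi Ha0. pose proof (curve_den_pos _ _ _ Hi Ha0) as HD0.
  pose proof (exp_pos M) as HM.
  set (d := Rmax (curve_den eta0 a0 + 1) (2 * Ti / exp M)).
  assert (Hd1 : curve_den eta0 a0 + 1 <= d) by apply Rmax_l.
  assert (Hd2 : 2 * Ti / exp M <= d) by apply Rmax_r.
  destruct (curve_den_onto eta0 ainf d Hi ltac:(lra)) as [a [Ha E]].
  pose proof (alpha_inf_bounds _ _ _ Hi Ha0). pose proof (alpha_inf_bounds _ _ _ Hi Ha).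
  exists a. split.
  - split; [lra|]. destruct (Rlt_or_le a a0) as [|[H'|H']]; [assumption| |subst; lra].
    pose proof (curve_den_decr eta0 a0 a). lra.
  - rewrite <- (ln_exp M). apply ln_increasing; [now apply (curve_T_pos _ _ ainf)|].
    unfold curve_T. rewrite E. apply Rlt_div_l; [lra|].
    assert (exp M * (2 * Ti / exp M) <= exp M * d) by (apply Rmult_le_compat_l; lra).
    replace (exp M * (2 * Ti / exp M)) with (2 * Ti) in * by (field; lra). nra.
Qed.

(** The comparison of [ln p] with [5/2 ln T] turns the unboundedness of [ln T] in
    both directions into that of [ln p]; intermediate values do the rest. *)
Lemma log_pressure_onto (Ti kappa eta0 ainf y : R) :
  0 < Ti -> 0 < kappa -> is_alpha_inf eta0 ainf ->
  exists a, 0 < a < ainf /\ log_pressure Ti kappa eta0 a = y.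
Proof.
  intros HTi Hk Hi. assert (Hinf : 0 < ainf) by apply Hi.
  set (c := ainf / 2). assert (Hc : 0 < c < ainf) by (unfold c; lra).
  set (K := log_pressure Ti kappa eta0 c - 5 / 2 * ln (curve_T Ti eta0 c)).
  destruct (curve_T_vanishes Ti eta0 ainf c ((y - K) * 2 / 5) HTi Hi Hc) as [a1 [H1 B1]].
  destruct (curve_T_unbounded Ti eta0 ainf c ((y - K) * 2 / 5) HTi Hi Hc) as [a2 [H2 B2]].
  pose proof (log_pressure_minus_T_increasing Ti kappa eta0 ainf a1 c HTi Hk Hi) as L1.
  pose proof (log_pressure_minus_T_increasing Ti kappa eta0 ainf c a2 HTi Hk Hi) as L2.
  fold K in L1, L2.
  destruct (IVT_interv (fun a => log_pressure Ti kappa eta0 a - y) a1 a2) as [a [Ha E]].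
  - intros a Ha. apply derivable_continuous_pt, ex_derive_Reals_0.
    assert (Ha' : 0 < a < ainf) by lra.
    pose proof (is_derive_log_pressure Ti kappa eta0 ainf a HTi Hk Hi Ha') as D.
    auto_derive. eexists; exact D.
  - lra.
  - lra.
  - lra.
  - exists a. split; lra.
Qed.

(** * Integral curves of the two fields *)

(** The derivative of [ln lambda] along [R_+], hence [R . grad lam / lambda] for
    both fields: reversing the thermodynamic components and changing the sign
    of [lam] compensate. *)
Definition log_lambda_growth (Ti a T : R) : R :=
  deg_speed Ti a T * log_lambda_a Ti a T + temp_speed Ti a T * log_lambda_T Ti a T.

Lemma ex_derive_log_lambda_growth (Ti : R) (al th : R -> R) (s : R) :
  0 < Ti -> 0 < al s < 1 -> 0 < th s -> ex_derive al s -> ex_derive th s ->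
  ex_derive (fun r => log_lambda_growth Ti (al r) (th r)) s.
Proof.
  intros HTi Ha HT [da Da] [dT DT].
  pose proof (coefA_gradient Ti _ _ HT al th s da dT eq_refl eq_refl Da DT) as DA.
  pose proof (coefB_gradient Ti _ _ HT al th s da dT eq_refl eq_refl Da DT) as DB.
  pose proof (coefA_pos Ti _ (th s) Ha) as HA.
  pose proof (coefB_pos Ti _ _ HTi Ha HT) as HB.
  assert (XA : ex_derive (fun r => coefA Ti (al r) (th r)) s) by (eexists; exact DA).
  assert (XB : ex_derive (fun r => coefB Ti (al r) (th r)) s) by (eexists; exact DB).
  clear DA DB.
  unfold log_lambda_growth, deg_speed, temp_speed, log_lambda_a, log_lambda_T, ioniz_C.
  set (fA := fun r => coefA Ti (al r) (th r)) in XA.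
  set (fB := fun r => coefB Ti (al r) (th r)) in XB.
  assert (HA' : 0 < fA s) by exact HA. assert (HB' : 0 < fB s) by exact HB.
  change (ex_derive fA s) in XA. change (ex_derive fB s) in XB.
  change (ex_derive (fun r =>
    / 2 * al r * (1 - al r ^ 2) * (Ti / th r) / fA r *
    (- 2 / (al r * (1 - al r ^ 2))
     + / 2 * (/ 2 * (1 - 2 * al r) * (5 / 2 + Ti / th r) ^ 2 / fA r
        - / (1 + al r)
        - / 2 * (1 - 2 * al r) * (15 / 4 + 3 * Ti / th r + Ti ^ 2 / th r ^ 2) / fB r))
    + (1 + / 2 * al r * (1 - al r) * (5 / 2 + Ti / th r)) / fA r * th r *
    ((5 / 2 + Ti / th r) / th r
     + / 2 * (- al r * (1 - al r) * (5 / 2 + Ti / th r) * Ti / th r ^ 2 / fA r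
        - / th r
        + / 2 * al r * (1 - al r) * (3 * Ti / th r ^ 2 + 2 * Ti ^ 2 / th r ^ 3) / fB r))) s).
  clearbody fA fB.
  assert (Xa : ex_derive al s) by (eexists; exact Da).
  assert (XT : ex_derive th s) by (eexists; exact DT).
  assert (0 < (1 - al s) * (1 + al s)) by (apply Rmult_lt_0_compat; lra).
  auto_derive. repeat split; try assumption;
    repeat apply Rmult_integral_contrapositive_currified; lra.
Qed.

(** [R_plus] and [R_minus] are the cases [sg = 1] and [sg = -1]: only their
    thermodynamic components change sign. *)
Definition signed_field (a2 Ti kappa sg : R) (q : state) : state :=
  State (sg * deg_speed Ti (deg q) (temp q))
        (pressure Ti kappa (deg q) (temp q) / lambda a2 Ti kappa (deg q) (temp q))
        (sg * temp_speed Ti (deg q) (temp q)).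

Definition signed_lambda (a2 Ti kappa sg : R) (q : state) : R :=
  sg * lambda a2 Ti kappa (deg q) (temp q).

Lemma R_plus_signed (a2 Ti kappa : R) : R_plus a2 Ti kappa = signed_field a2 Ti kappa 1.
Proof.
  apply functional_extensionality; intros [a u T].
  unfold R_plus, signed_field; simpl. now rewrite !Rmult_1_l.
Qed.

Lemma R_minus_signed (a2 Ti kappa : R) :
  R_minus a2 Ti kappa = signed_field a2 Ti kappa (-1).
Proof.
  apply functional_extensionality; intros [a u T].
  unfold R_minus, signed_field, deg_speed, temp_speed; simpl. f_equal; ring.
Qed.

Lemma lambda_plus_signed (a2 Ti kappa : R) :
  lambda_plus a2 Ti kappa = signed_lambda a2 Ti kappa 1.
Proof.
  apply functional_extensionality; intros q.
  unfold lambda_plus, signed_lambda. ring.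
Qed.

Lemma lambda_minus_signed (a2 Ti kappa : R) :
  lambda_minus a2 Ti kappa = signed_lambda a2 Ti kappa (-1).
Proof.
  apply functional_extensionality; intros q.
  unfold lambda_minus, signed_lambda. ring.
Qed.

Lemma along_signed (a2 Ti kappa sg : R) (q : state) :
  0 < a2 -> 0 < Ti -> 0 < kappa -> sg * sg = 1 -> admissible q ->
  along (signed_field a2 Ti kappa sg) (signed_lambda a2 Ti kappa sg) q
  = lambda a2 Ti kappa (deg q) (temp q) * log_lambda_growth Ti (deg q) (temp q).
Proof.
  intros Ha2 HTi Hk Hsg [Ha HT]. destruct q as [a u T]; simpl in *.
  destruct (has_gradient_partials _ _ _ _ _
    (lambda_gradient a2 Ti kappa a T Ha2 HTi Hk Ha HT)) as [Ea ET].
  unfold along, signed_field, signed_lambda; simpl.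
  rewrite (Derive_scal (fun b => lambda a2 Ti kappa b T)),
    (Derive_scal (fun S => lambda a2 Ti kappa a S)), Ea, ET, Derive_const.
  unfold log_lambda_growth.
  set (l := lambda _ _ _ _ _).
  transitivity (sg * sg * (l * (deg_speed Ti a T * log_lambda_a Ti a T +
    temp_speed Ti a T * log_lambda_T Ti a T))); [ring | rewrite Hsg; ring].
Qed.

(** The velocity component of the curve does not contribute, as [lam] depends on
    [deg] and [temp] only. *)
Lemma is_derive_signed_lambda (a2 Ti kappa sg : R) (q0 : state) lo hi (g : R -> state) (s : R) :
  0 < a2 -> 0 < Ti -> 0 < kappa -> sg * sg = 1 ->
  integral_curve (signed_field a2 Ti kappa sg) q0 lo hi g -> in_itv lo hi s ->
  is_derive (fun r => signed_lambda a2 Ti kappa sg (g r)) s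
    (along (signed_field a2 Ti kappa sg) (signed_lambda a2 Ti kappa sg) (g s)).
Proof.
  intros Ha2 HTi Hk Hsg [_ [_ Hg]] Hs. destruct (Hg s Hs) as [Hadm [Da [_ DT]]].
  rewrite along_signed by assumption. destruct Hadm as [Ha HT].
  pose proof (lambda_gradient a2 Ti kappa _ _ Ha2 HTi Hk Ha HT
    (fun r => deg (g r)) (fun r => temp (g r)) s _ _ eq_refl eq_refl Da DT) as D.
  simpl in D.
  pose proof (is_derive_scal _ _ sg _ D) as D'. unfold signed_lambda, log_lambda_growth.
  set (l := lambda _ _ _ _ _) in *. set (r1 := deg_speed _ _ _) in *.
  set (r3 := temp_speed _ _ _) in *. set (l1 := log_lambda_a _ _ _) in *.
  set (l3 := log_lambda_T _ _ _) in *.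
  replace (l * (r1 * l1 + r3 * l3)) with (sg * (l * l1 * (sg * r1) + l * l3 * (sg * r3)));
    [exact D'|].
  transitivity (sg * sg * (l * (r1 * l1 + r3 * l3))); [ring | rewrite Hsg; ring].
Qed.

Lemma entropy_along_integral_curve (a2 Ti kappa sg : R) q0 lo hi g (s : R) :
  0 < Ti -> integral_curve (signed_field a2 Ti kappa sg) q0 lo hi g ->
  in_itv lo hi s -> 0 <= s ->
  entropy Ti (deg (g s)) (temp (g s)) = entropy Ti (deg q0) (temp q0).
Proof.
  intros HTi [[H1 H2] [E0 Hg]] [Hs1 Hs2] [H|<-]; [|now rewrite E0].
  symmetry. rewrite <- E0.
  apply (eq_is_derive (fun r => entropy Ti (deg (g r)) (temp (g r))) 0 s); [|exact H].
  intros t Ht. destruct (Hg t) as [[Ha HT] [Da [_ DT]]].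
  - split; [apply Rbar_lt_le_trans with 0 | apply Rbar_le_lt_trans with s]; simpl; tauto.
  - pose proof (entropy_gradient Ti _ _ Ha HT
      (fun r => deg (g r)) (fun r => temp (g r)) t _ _ eq_refl eq_refl Da DT) as D.
    simpl in D. pose proof (characteristic_entropy Ti _ _ Ha HT) as E.
    replace (@zero R_NormedModule) with
      ((2 / (deg (g t) * (1 - deg (g t))) + (5 / 2 + Ti / temp (g t))) *
       (sg * deg_speed Ti (deg (g t)) (temp (g t))) +
       - Ti * (1 + deg (g t)) / temp (g t) ^ 2 *
       (sg * temp_speed Ti (deg (g t)) (temp (g t)))); [exact D|].
    change (@zero R_NormedModule) with 0. rewrite <- (Rmult_0_r sg), <- E. ring.
Qed.

Lemma deg_along_integral_curve (a2 Ti kappa sg : R) q0 lo hi g (s : R) :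
  0 < Ti -> sg * sg = 1 -> integral_curve (signed_field a2 Ti kappa sg) q0 lo hi g ->
  in_itv lo hi s -> 0 <= s -> 0 <= sg * (deg (g s) - deg q0).
Proof.
  intros HTi Hsg [[H1 H2] [E0 Hg]] [Hs1 Hs2] [H|<-]; [|rewrite E0; lra].
  enough (sg * deg (g 0) < sg * deg (g s)) by (rewrite <- E0; lra).
  apply (derive_pos_increasing (fun r => sg * deg (g r))
    (fun r => deg_speed Ti (deg (g r)) (temp (g r))) lo hi); try assumption.
  intros x Hx. destruct (Hg x Hx) as [[Ha HT] [Da _]].
  split; [|now apply deg_speed_pos].
  pose proof (is_derive_scal _ _ sg _ Da) as D. simpl in D.
  rewrite <- Rmult_assoc, Hsg, Rmult_1_l in D. exact D.
Qed.

(** The time along [R_+] is [ln p] up to the constant [c], so inverting [ln p] on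
    the isentrope solves the differential equation for all times. *)
Lemma isentrope_flow (Ti kappa eta0 ainf c : R) :
  0 < Ti -> 0 < kappa -> is_alpha_inf eta0 ainf ->
  exists al th : R -> R, forall s,
    0 < al s < ainf /\ log_pressure Ti kappa eta0 (al s) = c + s /\
    th s = curve_T Ti eta0 (al s) /\
    is_derive al s (deg_speed Ti (al s) (th s)) /\
    is_derive th s (temp_speed Ti (al s) (th s)).
Proof.
  intros HTi Hk Hi.
  set (L := log_pressure Ti kappa eta0).
  assert (DL : forall a, 0 < a < ainf ->
     is_derive L a (/ deg_speed Ti a (curve_T Ti eta0 a)) /\
     0 < / deg_speed Ti a (curve_T Ti eta0 a)).
  { intros a Ha. split; [now apply is_derive_log_pressure with ainf|].
    apply Rinv_0_lt_compat, deg_speed_pos; [assumption | now apply (alpha_inf_bounds eta0 ainf) |].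
    now apply (curve_T_pos _ _ ainf). }
  set (h := fun y => iota (fun a : R => 0 < a < ainf /\ L a = y) : R).
  assert (Hh : forall y, 0 < h y < ainf /\ L (h y) = y).
  { intros y. apply (iota_correct (fun a : R => 0 < a < ainf /\ L a = y)).
    destruct (log_pressure_onto Ti kappa eta0 ainf y HTi Hk Hi) as [a [Ha E]].
    exists a. split; [now split|]. intros b [Hb Eb]. fold L in E.
    apply (log_pressure_inj Ti kappa eta0 ainf); try assumption. fold L. lra. }
  pose proof (is_derive_right_inverse L _ h 0 ainf DL Hh) as Dh.
  exists (fun s => h (c + s)), (fun s => curve_T Ti eta0 (h (c + s))). intros s.
  destruct (Hh (c + s)) as [Hb EL].
  assert (Dal : is_derive (fun s => h (c + s)) s
            (deg_speed Ti (h (c + s)) (curve_T Ti eta0 (h (c + s))))).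
  { pose proof (Dh (c + s)) as D. cbv beta in D. rewrite Rinv_inv in D.
    auto_derive; [eexists; exact D|].
    change (Derive (fun x => h x) (c + s)) with (Derive h (c + s)).
    rewrite (is_derive_unique _ _ _ D). ring. }
  assert (Hr : 0 < deg_speed Ti (h (c + s)) (curve_T Ti eta0 (h (c + s)))).
  { destruct (DL _ Hb) as [_ Hp]. apply Rinv_0_lt_compat in Hp. now rewrite Rinv_inv in Hp. }
  split; [exact Hb|]. split; [exact EL|]. split; [reflexivity|]. split; [exact Dal|].
  pose proof (is_derive_comp (curve_T Ti eta0) (fun s => h (c + s)) s _ _
    (is_derive_curve_T _ _ _ _ HTi Hi Hb) Dal) as D.
  replace (temp_speed Ti (h (c + s)) (curve_T Ti eta0 (h (c + s)))) with
    (scal (deg_speed Ti (h (c + s)) (curve_T Ti eta0 (h (c + s))))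
      (temp_speed Ti (h (c + s)) (curve_T Ti eta0 (h (c + s)))
       / deg_speed Ti (h (c + s)) (curve_T Ti eta0 (h (c + s))))); [exact D|].
  unfold scal; simpl; unfold mult; simpl. field. lra.
Qed.

Lemma is_derive_reparam (f : R -> R) (sg d s : R) :
  is_derive f (sg * s) d -> is_derive (fun r => f (sg * r)) s (sg * d).
Proof.
  intros D. auto_derive; [eexists; exact D|].
  change (Derive (fun x => f x) (sg * s)) with (Derive f (sg * s)).
  rewrite (is_derive_unique _ _ _ D). ring.
Qed.

Lemma is_derive_primitive (w : R -> R) (u0 s : R) :
  (forall r, continuous w r) -> is_derive (fun r => u0 + RInt w 0 r) s (w s).
Proof.
  intros Hw.
  assert (D : is_derive (fun r => RInt w 0 r) s (w s)).
  { apply (is_derive_RInt w _ 0); [|apply Hw].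
    apply filter_forall. intros b. apply (RInt_correct (V := R_CompleteNormedModule)).
    apply (ex_RInt_continuous (V := R_CompleteNormedModule)). intros; apply Hw. }
  replace (w s) with (plus 0 (w s)) by (unfold plus; simpl; ring).
  apply (is_derive_plus (V := R_NormedModule)); [|exact D].
  apply (is_derive_const (V := R_NormedModule)).
Qed.

(** Running the flow of the isentrope at time [sg * s] gives the thermodynamic
    components; the velocity is then a plain integral, because its right-hand
    side [p / lambda] does not depend on the velocity. *)
Lemma global_integral_curve (a2 Ti kappa sg a0 u0 T0 ainf : R) :
  0 < a2 -> 0 < Ti -> 0 < kappa -> 0 < a0 < 1 -> 0 < T0 ->
  is_alpha_inf (entropy Ti a0 T0) ainf ->
  exists g, integral_curve (signed_field a2 Ti kappa sg) (State a0 u0 T0) m_infty p_infty g /\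
    (forall s, 0 < deg (g s) < ainf /\
       temp (g s) = curve_T Ti (entropy Ti a0 T0) (deg (g s)) /\
       log_pressure Ti kappa (entropy Ti a0 T0) (deg (g s))
       = log_pressure Ti kappa (entropy Ti a0 T0) a0 + sg * s) /\
    (forall s, continuous (fun r => lambda a2 Ti kappa (deg (g r)) (temp (g r))
        * log_lambda_growth Ti (deg (g r)) (temp (g r))) s).
Proof.
  intros Ha2 HTi Hk Ha0 HT0 Hi. set (eta0 := entropy Ti a0 T0) in *.
  destruct (isentrope_is_graph Ti eta0 ainf a0 T0 HTi Hi Ha0 HT0 eq_refl) as [Hb0 ET0].
  destruct (isentrope_flow Ti kappa eta0 ainf (log_pressure Ti kappa eta0 a0) HTi Hk Hi)
    as [al [th Hflow]].
  assert (Hadm : forall s, 0 < al s < 1 /\ 0 < th s).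
  { intros s. destruct (Hflow s) as [H1 [_ [-> _]]]. split.
    - now apply (alpha_inf_bounds eta0 ainf).
    - now apply (curve_T_pos _ _ ainf). }
  assert (Dal : forall s, is_derive (fun r => al (sg * r)) s
      (sg * deg_speed Ti (al (sg * s)) (th (sg * s))))
    by (intros s; apply is_derive_reparam, Hflow).
  assert (Dth : forall s, is_derive (fun r => th (sg * r)) s
      (sg * temp_speed Ti (al (sg * s)) (th (sg * s))))
    by (intros s; apply is_derive_reparam, Hflow).
  assert (Xl : forall s, ex_derive (fun r => lambda a2 Ti kappa (al (sg * r)) (th (sg * r))) s).
  { intros s. destruct (Hadm (sg * s)) as [Ha HT]. eexists.
    exact (lambda_gradient a2 Ti kappa _ _ Ha2 HTi Hk Ha HT _ _ s _ _ eq_refl eq_refl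
      (Dal s) (Dth s)). }
  set (w := fun r => pressure Ti kappa (al (sg * r)) (th (sg * r))
                     / lambda a2 Ti kappa (al (sg * r)) (th (sg * r))).
  assert (Cw : forall s, continuous w s).
  { intros s. apply (ex_derive_continuous w). destruct (Hadm (sg * s)) as [Ha HT].
    unfold w. apply (ex_derive_div (fun r => pressure Ti kappa (al (sg * r)) (th (sg * r)))).
    - eexists.
      exact (pressure_gradient Ti kappa _ _ Hk Ha HT _ _ s _ _ eq_refl eq_refl (Dal s) (Dth s)).
    - apply Xl.
    - apply Rgt_not_eq, sqrt_lt_R0, lambda_sq_pos; assumption. }
  exists (fun s => State (al (sg * s)) (u0 + RInt w 0 s) (th (sg * s))).
  split; [|split].
  - split; [split; exact I | split].
    + rewrite RInt_point, Rmult_0_r. destruct (Hflow 0) as [H1 [H2 [H3 _]]].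
      assert (E : al 0 = a0).
      { apply (log_pressure_inj Ti kappa eta0 ainf); try assumption. lra. }
      rewrite H3, E, <- ET0. f_equal. change (u0 + 0 = u0). ring.
    + intros s _. split; [apply Hadm|]. split; [apply Dal|]. split; [|apply Dth].
      exact (is_derive_primitive w u0 s Cw).
  - intros s. simpl. destruct (Hflow (sg * s)) as [H1 [H2 [H3 _]]]. tauto.
  - intros s. simpl. destruct (Hadm (sg * s)) as [Ha HT].
    apply (continuous_mult (K := R_AbsRing)).
    + apply (ex_derive_continuous (V := R_NormedModule)), Xl.
    + apply (ex_derive_continuous (V := R_NormedModule)).
      apply (ex_derive_log_lambda_growth Ti (fun r => al (sg * r)) (fun r => th (sg * r)));
        try assumption; eexists; [apply Dal | apply Dth].
Qed.

Lemma global_curve_maximal (X : state -> state) (q0 : state) (g : R -> state) :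
  integral_curve X q0 m_infty p_infty g -> maximal_integral_curve X q0 m_infty p_infty g.
Proof.
  intros Hg. split; [exact Hg|]. intros lo hi g' _ H.
  assert (Hall : forall s : R, in_itv lo hi s) by (intros s; now apply H).
  split.
  - destruct lo as [r| |]; [|destruct (Hall 0) as [[] _]|reflexivity].
    destruct (Hall r) as [Hr _]. simpl in Hr. lra.
  - destruct hi as [r| |]; [|reflexivity|destruct (Hall 0) as [_ []]].
    destruct (Hall r) as [_ Hr]. simpl in Hr. lra.
Qed.

(** * Rarefaction curves *)

Lemma increasing_away_forward (f : R -> R) (d s : R) :
  is_derive f 0 d -> 0 < d -> increasing_away f s -> 0 <= s.
Proof.
  intros Df Hd Hinc. destruct (Rle_or_lt 0 s) as [|Hs]; [assumption|exfalso].
  destruct (derive_pos_left f 0 d Df Hd) as [e He]. pose proof (cond_pos e).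
  set (y := Rmax s (- e / 2)).
  assert (Hy : s <= y /\ - e < y < 0) by (unfold y; apply Rmax_case_strong; lra).
  specialize (He y ltac:(lra)). specialize (Hinc 0 y ltac:(lra)). lra.
Qed.

(** For both signs, the rarefaction curve is the part of the isentrope where
    [a - a0] vanishes or has the sign of [sg]. *)
Lemma signed_rarefaction (a2 Ti kappa sg a0 u0 T0 ainf : R) :
  0 < a2 -> 0 < Ti -> 0 < kappa -> sg * sg = 1 -> 0 < a0 < 1 -> 0 < T0 ->
  is_alpha_inf (entropy Ti a0 T0) ainf ->
  let X := signed_field a2 Ti kappa sg in
  let lam := signed_lambda a2 Ti kappa sg in
  let raref := rarefaction_curve X lam (State a0 u0 T0) in
  (forall q, raref q -> 0 < along X lam q) ->
  forall a T, projection raref a T <->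
    (0 < a < ainf /\ 0 <= sg * (a - a0)) /\ T = curve_T Ti (entropy Ti a0 T0) a.
Proof.
  intros Ha2 HTi Hk Hsg Ha0 HT0 Hi X lam raref Hnl a T.
  set (eta0 := entropy Ti a0 T0) in *.
  destruct (isentrope_is_graph Ti eta0 ainf a0 T0 HTi Hi Ha0 HT0 eq_refl) as [Hb0 ET0].
  destruct (global_integral_curve a2 Ti kappa sg a0 u0 T0 ainf Ha2 HTi Hk Ha0 HT0 Hi)
    as [g [Hg [Hgraph Hcont]]]. fold X eta0 in Hg, Hgraph.
  pose proof (global_curve_maximal _ _ _ Hg) as Hmax.
  assert (Hreal : forall s : R, in_itv m_infty p_infty s) by (intros s; split; exact I).
  split.
  - intros [u [lo [hi [g' [s [[Hg' _] [Hs [Es Hinc]]]]]]]].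
    assert (Hlo0 := proj1 Hg').
    assert (E0 := proj1 (proj2 Hg')).
    assert (D0 := is_derive_signed_lambda a2 Ti kappa sg _ lo hi g' 0 Ha2 HTi Hk Hsg Hg' Hlo0).
    fold X lam in D0. rewrite E0 in D0.
    (* the initial state itself lies on the rarefaction curve, reached at time 0 *)
    assert (Hs0 : 0 <= s).
    { apply (increasing_away_forward _ _ s D0); [|exact Hinc]. apply Hnl.
      exists m_infty, p_infty, g, 0. split; [exact Hmax|]. split; [apply Hreal|].
      split; [apply Hg|]. intros r1 r2 H. lra. }
    pose proof (entropy_along_integral_curve _ _ _ _ _ _ _ _ s HTi Hg' Hs Hs0) as Ee.
    pose proof (deg_along_integral_curve _ _ _ _ _ _ _ _ s HTi Hsg Hg' Hs Hs0) as Ed.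
    destruct (proj2 (proj2 Hg') s Hs) as [[Ha HT] _].
    rewrite Es in *. simpl in *.
    destruct (isentrope_is_graph Ti eta0 ainf a T HTi Hi Ha HT Ee). tauto.
  - intros [[Ha Hdir] ->].
    (* the time at which the global curve reaches degree [a] *)
    set (s := sg * (log_pressure Ti kappa eta0 a - log_pressure Ti kappa eta0 a0)).
    assert (Es : sg * s = log_pressure Ti kappa eta0 a - log_pressure Ti kappa eta0 a0)
      by (unfold s; rewrite <- Rmult_assoc, Hsg; ring).
    assert (Hs : 0 <= s).
    { destruct (Rtotal_order a a0) as [H|[H|H]].
      - pose proof (log_pressure_increasing Ti kappa eta0 ainf a a0 HTi Hk Hi
          ltac:(lra) H ltac:(lra)).
        assert (sg < 0) by nra. unfold s. nra.
      - unfold s. rewrite H. lra.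
      - pose proof (log_pressure_increasing Ti kappa eta0 ainf a0 a HTi Hk Hi
          ltac:(lra) H ltac:(lra)).
        assert (0 < sg) by nra. unfold s. nra. }
    destruct (Hgraph s) as [Hd [Et El]].
    assert (Edeg : deg (g s) = a).
    { apply (log_pressure_inj Ti kappa eta0 ainf); try assumption. lra. }
    exists (vel (g s)), m_infty, p_infty, g, s.
    split; [exact Hmax|]. split; [apply Hreal|]. split.
    { rewrite <- Edeg, <- Et. now destruct (g s). }
    assert (Hmono : forall r1 r2, 0 <= r1 < r2 -> lam (g r1) < lam (g r2)).
    { apply (increasing_continuation (fun r => lam (g r)) (fun r => along X lam (g r))).
      - intros t. exact (is_derive_signed_lambda a2 Ti kappa sg _ _ _ g t Ha2 HTi Hk Hsg Hg (Hreal t)).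
      - intros t.
        apply (continuous_ext (fun r => lambda a2 Ti kappa (deg (g r)) (temp (g r))
          * log_lambda_growth Ti (deg (g r)) (temp (g r)))); [|apply Hcont].
        intros r. symmetry. apply along_signed; try assumption.
        apply (proj2 (proj2 Hg) r (Hreal r)).
      - intros t Ht Hinc. apply Hnl. exists m_infty, p_infty, g, t.
        split; [exact Hmax|]. split; [apply Hreal|]. split; [reflexivity|].
        intros r1 r2 [H|H]; [apply Hinc|]; lra. }
    intros r1 r2 [H|H]; [apply Hmono|]; lra.
Qed.

Theorem theorem7p1 (a2 Ti kappa : R)
    (ha2 : 0 < a2) (hTi : 0 < Ti) (hkappa : 0 < kappa) :
  (forall eta0 ainf : R, is_alpha_inf eta0 ainf ->
     forall a : R, 0 < a < ainf ->
       exists d : R,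
         is_derive (fun b : R => pressure Ti kappa b (curve_T Ti eta0 b)) a d
         /\ 0 < d)
  /\
  (forall a0 u0 T0 ainf : R, 0 < a0 < 1 -> 0 < T0 ->
     is_alpha_inf (entropy Ti a0 T0) ainf ->
     let Rm := R_minus a2 Ti kappa in
     let Rp := R_plus a2 Ti kappa in
     let lm := lambda_minus a2 Ti kappa in
     let lp := lambda_plus a2 Ti kappa in
     let raref1 := rarefaction_curve Rm lm (State a0 u0 T0) in
     let raref2 := rarefaction_curve Rp lp (State a0 u0 T0) in
     ((forall q : state, raref1 q -> 0 < along Rm lm q) ->
        forall a T : R,
          projection raref1 a T <->
          0 < a <= a0 /\ T = curve_T Ti (entropy Ti a0 T0) a)
     /\
     ((forall q : state, raref2 q -> 0 < along Rp lp q) ->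
        forall a T : R,
          projection raref2 a T <->
          a0 <= a < ainf /\ T = curve_T Ti (entropy Ti a0 T0) a)).
Proof.
  split.
  - intros eta0 ainf Hi a Ha.
    pose proof (alpha_inf_bounds _ _ _ Hi Ha) as Ha1.
    eexists. split; [now apply is_derive_pressure_curve with ainf|].
    apply Rdiv_lt_0_compat; [now apply pressure_pos|].
    apply deg_speed_pos; try assumption. now apply (curve_T_pos _ _ ainf).
  - intros a0 u0 T0 ainf Ha0 HT0 Hi Rm Rp lm lp raref1 raref2.
    destruct (isentrope_is_graph Ti _ ainf a0 T0 hTi Hi Ha0 HT0 eq_refl) as [Hb0 _].
    assert (Hpm : 1 * 1 = 1 /\ -1 * -1 = 1) by (split; ring). destruct Hpm as [Hp Hm].
    subst Rm Rp lm lp raref1 raref2.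
    rewrite R_minus_signed, R_plus_signed, lambda_minus_signed, lambda_plus_signed.
    split; intros Hnl a T.
    + rewrite (signed_rarefaction a2 Ti kappa (-1) a0 u0 T0 ainf ha2 hTi hkappa Hm Ha0 HT0 Hi Hnl).
      split; intros [H1 H2]; (split; [|exact H2]); lra.
    + rewrite (signed_rarefaction a2 Ti kappa 1 a0 u0 T0 ainf ha2 hTi hkappa Hp Ha0 HT0 Hi Hnl).
      split; intros [H1 H2]; (split; [|exact H2]); lra.
Qed.
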